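(* Assume that $u^n\in\mathcal{C}_h$ and $0<u^n_{i,j}<1$ for all $i,j$. For any time step size $\tau>0$, there exists a unique $u^{n+1}\in\mathcal{C}_h$ (necessarily with values in $(0,1)$, so that the logarithms are defined) solving $$\frac{u^{n+1}-u^n}{\tau}-\epsilon^2\Delta_hu^{n+1}+\log(u^{n+1})-\log(1-u^{n+1})+\theta(1-2u^n)=0 .$$
   Context: Fix $L>0$, a positive integer $N$, $h=L/N$, and parameters $\epsilon>0$, $\theta>2$. $\mathcal{C}_h$ is the real vector space of doubly $N$-periodic grid functions $\phi=(\phi_{i,j})_{i,j\in\mathbb{Z}}$, $\phi_{i,j}=\phi_{i+\lambda N,j+\mu N}$ for all $i,j,\lambda,\mu\in\mathbb{Z}$. The discrete Laplacian is $(\Delta_h\phi)_{i,j}=\frac1{h^2}(\phi_{i+1,j}+\phi_{i-1,j}+\phi_{i,j+1}+\phi_{i,j-1}-4\phi_{i,j})$. Functions such as $\log$ are applied pointwise, and scalars denote constant grid functions. *)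

(* Defs.v *)
From mathcomp Require Import all_boot all_order all_algebra.
From mathcomp Require Import all_classical all_reals all_analysis.
Set Implicit Arguments.
Unset Strict Implicit.
Unset Printing Implicit Defensive.
Import Order.TTheory GRing.Theory Num.Theory.
Local Open Scope classical_set_scope.
Local Open Scope ring_scope.

Definition grid_fun (R : realType) (N : nat) : set (int -> int -> R) :=
  [set phi | forall i j l m : int, phi i j = phi (i + l * N%:Z) (j + m * N%:Z)].

Definition discrete_laplacian (R : realType) (h : R) (phi : int -> int -> R) :
    int -> int -> R := fun i j =>
  (h ^+ 2)^-1 * (phi (i + 1) j + phi (i - 1) j + phi i (j + 1) + phi i (j - 1)
                 - 4 * phi i j).

(* [ln] is total, with junk value 0 on nonpositive arguments, so the condition
   0 < v < 1 under which both logarithms are defined is part of being a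
   solution. *)
Definition scheme_solution (R : realType) (N : nat) (h eps theta tau : R)
    (u v : int -> int -> R) : Prop :=
  [/\ grid_fun N v,
      forall i j : int, 0 < v i j < 1 &
      forall i j : int,
        (v i j - u i j) / tau - eps ^+ 2 * discrete_laplacian h v i j
        + ln (v i j) - ln (1 - v i j) + theta * (1 - 2 * u i j) = 0].

(* Main.v *)
Require Import Defs.
From mathcomp Require Import all_boot all_order all_algebra.
From mathcomp Require Import all_classical all_reals all_analysis.
From mathcomp Require Import ring lra.
Set Implicit Arguments.
Unset Strict Implicit.
Unset Printing Implicit Defensive.
Import Order.TTheory GRing.Theory Num.Theory.
Import numFieldNormedType.Exports.
Local Open Scope ring_scope.

(** Moving every term at the centre of the five-point stencil to the left turns
    the scheme into the fixed-point problem

      g (v i j) = b i j + c * (sum of the four neighbours of v at i, j),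

    with c = eps^2 / h^2 and g x = (1/tau + 4c) x + ln x - ln (1 - x)
    ([scheme_solutionP]); the concave part of the potential is explicit, so it
    only enters the data b. The logarithms make g an increasing bijection from
    ]0, 1[ onto the real line ([reaction_surjective]) that expands distances by
    the factor K = 1/tau + 4c at least ([reaction_dist]). Its inverse G is
    therefore increasing and 1/K-Lipschitz, with values in ]0, 1[.

    The map v |-> G (b + c * neighbours of v) is order preserving and contracts
    the sup norm by q = 4c / K < 1, for every tau > 0. Order preservation gives
    existence: the iterates from 0 increase, stay below 1 and converge pointwise
    to a fixed point ([coupled_solution_exists]). Contraction gives uniqueness:
    two fixed points differ by at most 1, hence by at most q^n for all n
    ([coupled_solution_unique]). Uniqueness in turn yields periodicity: the
    translates of the solution by periods of the data solve the same problem,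
    hence coincide with it. *)

Definition reaction (R : realType) (K x : R) : R := K * x + ln x - ln (1 - x).

Definition neighbour_sum (R : realType) (v : int -> int -> R) (i j : int) : R :=
  v (i + 1) j + v (i - 1) j + v i (j + 1) + v i (j - 1).

(** No periodicity is imposed, so that translates and iterates can be handled
    pointwise on the whole lattice. *)
Definition coupled_solution (R : realType) (K c : R) (b v : int -> int -> R) : Prop :=
  (forall i j, 0 < v i j < 1) /\
  forall i j, reaction K (v i j) = b i j + c * neighbour_sum v i j.

(** The two logarithmic terms are increasing, so the linear term alone bounds
    the growth from below. *)
Lemma reaction_expanding (R : realType) (K x y : R) :
  0 < y -> y <= x -> x < 1 -> K * (x - y) <= reaction K x - reaction K y.
Proof.
move=> y0 yx x1; rewrite /reaction.
have l1 : ln y <= ln x by rewrite ler_ln ?posrE //; lra.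
have l2 : ln (1 - x) <= ln (1 - y) by rewrite ler_ln ?posrE //; lra.
lra.
Qed.

Lemma reaction_dist (R : realType) (K x y : R) : 0 <= K ->
  0 < x < 1 -> 0 < y < 1 -> K * `|x - y| <= `|reaction K x - reaction K y|.
Proof.
move=> K0.
wlog yx : x y / y <= x.
  move=> H hx hy; case: (leP y x) => [/H|/ltW /H]; first exact.
  by rewrite distrC (distrC (reaction K y)); apply.
move=> /andP[x0 x1] /andP[y0 y1].
rewrite (@ger0_norm _ (x - y)) ?subr_ge0 //.
exact: le_trans (reaction_expanding K y0 yx x1) (ler_norm _).
Qed.

Lemma reaction_reflects_le (R : realType) (K x y : R) : 0 < K ->
  0 < x < 1 -> 0 < y < 1 -> reaction K x <= reaction K y -> x <= y.
Proof.
move=> K0 /andP[x0 x1] /andP[y0 y1] rxy; rewrite leNgt; apply/negP => yx.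
have := reaction_expanding K y0 (ltW yx) x1.
have : 0 < K * (x - y) by rewrite mulr_gt0 // subr_gt0.
lra.
Qed.

(** The logistic function [sigma] parametrizes ]0, 1[ by the real line and
    inverts x |-> ln x - ln (1 - x), so the equation becomes
    K * sigma s + s = y, with no singular endpoint left. *)
Lemma reaction_surjective (R : realType) (K y : R) : 0 <= K ->
  exists x : R, 0 < x < 1 /\ reaction K x = y.
Proof.
move=> K0.
pose sigma (s : R) := (1 + expR (- s))^-1.
have den (s : R) : 0 < expR (- s) by exact: expR_gt0.
have sigma01 s : 0 < sigma s < 1.
  by rewrite /sigma invr_gt0 invf_lt1; have := den s; lra.
have reaction_sigma s : reaction K (sigma s) = K * sigma s + s.
  have e0 := den s.
  rewrite /reaction.
  have -> : 1 - sigma s = expR (- s) * sigma s.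
    by rewrite /sigma; field; lra.
  have s0 : 0 < sigma s by case/andP: (sigma01 s).
  by rewrite lnM ?posrE // expRK; ring.
have cont : continuous (fun s : R => K * sigma s + s).
  move=> s; apply: cvgD; last exact: cvg_id.
  apply: cvgMl_tmp; apply: cvgV; first by have := den s; lra.
  apply: cvgD; first exact: cvg_cst.
  apply: cvg_comp; first by apply: cvgN; exact: cvg_id.
  exact: continuous_expR.
have [c _ fc] : exists2 c, c \in `[y - K, y] & K * sigma c + c = y.
  (* As 0 <= K * sigma s <= K, the values at y - K and y enclose y. *)
  apply: IVT; first by lra.
    by apply: continuous_subspaceT => s; exact: cont.
  have /andP[a0 a1] := sigma01 (y - K); have /andP[b0 b1] := sigma01 y.
  rewrite ge_min le_max; apply/andP; split; apply/orP; [left|right]; nra.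
by exists (sigma c); rewrite reaction_sigma.
Qed.

Lemma neighbour_sum_le (R : realType) (v w : int -> int -> R) i j :
  (forall i j, v i j <= w i j) -> neighbour_sum v i j <= neighbour_sum w i j.
Proof. by move=> vw; rewrite /neighbour_sum !lerD. Qed.

Lemma neighbour_sum_dist (R : realType) (v w : int -> int -> R) M i j :
  (forall i j, `|v i j - w i j| <= M) ->
  `|neighbour_sum v i j - neighbour_sum w i j| <= 4 * M.
Proof.
move=> H.
have := H (i + 1) j; have := H (i - 1) j; have := H i (j + 1); have := H i (j - 1).
rewrite /neighbour_sum !ler_norml; lra.
Qed.

Lemma neighbour_sum_cvg (R : realType) (v : nat -> int -> int -> R) w i j :
  (forall i j, (v n i j @[n --> \oo] --> w i j)%classic) ->
  (neighbour_sum (v n) i j @[n --> \oo] --> neighbour_sum w i j)%classic.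
Proof. by move=> H; rewrite /neighbour_sum; do !apply: cvgD. Qed.

(** At each point, K |v - w| is at most c times the sum of four neighbouring
    differences, so a bound M on |v - w| improves to (4c / K) M. *)
Lemma coupled_solution_unique (R : realType) (K c : R) (b v w : int -> int -> R) :
  0 <= c -> 4 * c < K -> coupled_solution K c b v -> coupled_solution K c b w ->
  forall i j, v i j = w i j.
Proof.
move=> c0 cK [v01 vE] [w01 wE].
have K0 : 0 < K by lra.
pose q := 4 * c / K.
have q0 : 0 <= q by rewrite /q divr_ge0 //; lra.
have q1 : q < 1 by rewrite /q ltr_pdivrMr // mul1r.
have qK : K * q = 4 * c by rewrite /q; field; lra.
have bound n : forall i j, `|v i j - w i j| <= q ^+ n.
  elim: n => [|n IH] i j.
    (* Both solutions take values in ]0, 1[, which starts the iteration. *)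
    by rewrite expr0 ler_norml; have := v01 i j; have := w01 i j; lra.
  have := reaction_dist (ltW K0) (v01 i j) (w01 i j).
  rewrite vE wE opprD addrACA subrr add0r -mulrBr normrM (ger0_norm c0) => H.
  rewrite -(ler_pM2l K0) exprS mulrA qK; apply: (le_trans H).
  by rewrite -mulrA mulrCA ler_wpM2l //; exact: neighbour_sum_dist.
move=> i j; apply/eqP; rewrite -subr_eq0 -normr_le0.
have cv : (q ^+ n @[n --> \oo] --> 0)%classic.
  by apply: cvg_expr; rewrite ger0_norm.
by apply: (cvgr_to_ge cv); apply: nearW => n; exact: bound.
Qed.

(** Monotone iteration for T v = G (b + c * neighbours of v). The iterates
    converge pointwise in the closed interval [0, 1]; the limit is in the open
    interval because it is a value of G. *)
Lemma coupled_solution_exists (R : realType) (K c : R) (b : int -> int -> R) :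
  0 <= c -> 0 < K -> exists v, coupled_solution K c b v.
Proof.
move=> c0 K0.
have [G GP] := choice (fun y => reaction_surjective y (ltW K0)).
have G01 y : 0 < G y < 1 by case: (GP y).
have rG y : reaction K (G y) = y by case: (GP y).
have G_le x y : x <= y -> G x <= G y.
  by move=> xy; apply: (reaction_reflects_le K0) => //; rewrite !rG.
have G_dist x y : K * `|G x - G y| <= `|x - y|.
  by rewrite -{2}(rG x) -{2}(rG y); apply: reaction_dist => //; exact: ltW.
have G_cont : continuous G.
  move=> x; apply/cvgrPdist_le => e e0; near=> y.
  rewrite -(ler_pM2l K0); apply: (le_trans (G_dist _ _)).
  near: y; apply: cvgr_dist_le; last exact: mulr_gt0.
  exact: cvg_id.
pose T (v : int -> int -> R) i j := G (b i j + c * neighbour_sum v i j).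
pose V n := iter n T (fun _ _ => 0).
have V01 n i j : 0 <= V n i j <= 1.
  case: n => [|n]; first by rewrite /V /= lexx ler01.
  by have /andP[/ltW -> /ltW ->] := G01 (b i j + c * neighbour_sum (V n) i j).
have V_succ n : forall i j, V n i j <= V n.+1 i j.
  elim: n => [|n IH] i j; first by case/andP: (V01 1%N i j).
  by apply: G_le; rewrite lerD2l ler_wpM2l //; exact: neighbour_sum_le.
have V_cvg i j : cvgn (V ^~ i ^~ j).
  apply: nondecreasing_is_cvgn; first by apply/nondecreasing_seqP => n; exact: V_succ.
  by exists 1 => _ [n _ <-]; case/andP: (V01 n i j).
pose v i j := limn (V ^~ i ^~ j).
have v_fixed i j : v i j = T v i j.
  have lim1 : (V n.+1 i j @[n --> \oo] --> v i j)%classic.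
    by rewrite (cvg_shiftS (V ^~ i ^~ j)); exact: V_cvg.
  have lim2 : (T (V n) i j @[n --> \oo] --> T v i j)%classic.
    apply: (continuous_cvg _ (G_cont _)).
        apply: cvgD; first exact: cvg_cst.
    by apply: cvgMl_tmp; apply: neighbour_sum_cvg => i' j'; exact: V_cvg.
  exact: (cvg_unique _ lim1 lim2).
exists v; split=> i j; rewrite v_fixed ?G01 //.
by rewrite [LHS]rG.
Unshelve. all: by end_near. Qed.

Lemma coupled_solution_shift (R : realType) (K c : R) (b v : int -> int -> R) (p q : int) :
  coupled_solution K c b v ->
  coupled_solution K c (fun i j => b (i + p) (j + q)) (fun i j => v (i + p) (j + q)).
Proof.
move=> [v01 vE]; split=> i j //.
by rewrite vE /neighbour_sum ![_ + 1 + _]addrAC ![_ - 1 + _]addrAC.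
Qed.

Lemma scheme_solutionP (R : realType) (N : nat) (h eps theta tau : R)
    (u v : int -> int -> R) :
  let c := eps ^+ 2 * (h ^+ 2)^-1 in
  scheme_solution N h eps theta tau u v <->
  grid_fun N v /\
  coupled_solution (tau^-1 + 4 * c) c
    (fun i j => u i j / tau - theta * (1 - 2 * u i j)) v.
Proof.
move=> c.
have E i j : (v i j - u i j) / tau - eps ^+ 2 * discrete_laplacian h v i j
      + ln (v i j) - ln (1 - v i j) + theta * (1 - 2 * u i j)
    = reaction (tau^-1 + 4 * c) (v i j)
      - (u i j / tau - theta * (1 - 2 * u i j) + c * neighbour_sum v i j).
  rewrite /reaction /discrete_laplacian /neighbour_sum /c; ring.
split=> [[vN v01 vE]|[vN [v01 vE]]].
  by split=> //; split=> // i j; apply/eqP; rewrite -subr_eq0 -E vE.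
by split=> // i j; rewrite E vE subrr.
Qed.

Theorem theorem4p1 (R : realType) (L : R) (N : nat) (eps theta : R)
    (L_gt0 : 0 < L) (N_gt0 : (0 < N)%N) (eps_gt0 : 0 < eps) (theta_gt2 : 2 < theta)
    (u : int -> int -> R) (u_grid : grid_fun N u)
    (u_range : forall i j : int, 0 < u i j < 1) (tau : R) (tau_gt0 : 0 < tau) :
  exists! v : int -> int -> R,
    scheme_solution N (L / N%:R) eps theta tau u v.
Proof.
set h := L / N%:R.
pose c := eps ^+ 2 * (h ^+ 2)^-1.
have c0 : 0 <= c by rewrite mulr_ge0 ?invr_ge0 ?sqr_ge0.
have cK : 4 * c < tau^-1 + 4 * c by rewrite ltrDr invr_gt0.
have K0 : 0 < tau^-1 + 4 * c by lra.
pose b i j := u i j / tau - theta * (1 - 2 * u i j).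
have [v vS] := coupled_solution_exists b c0 K0.
exists v; split.
  apply/scheme_solutionP; split; last exact: vS.
  move=> i j l m.
  (* The data are invariant under the period, so the translate of v solves the
     same problem as v. *)
  have := coupled_solution_shift (l * N%:Z) (m * N%:Z) vS.
  rewrite (_ : (fun _ _ => b _ _) = b) => [vS'|].
    exact: (coupled_solution_unique c0 cK vS vS' i j).
  by apply/funext => i'; apply/funext => j'; rewrite /b -u_grid.
move=> w /scheme_solutionP[_ wS].
apply/funext => i; apply/funext => j.
exact: (coupled_solution_unique c0 cK vS wS i j).
Qed.
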